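(* Let $B$ be a nilpotent $n\times n$ matrix over $\mathbb{F}$. If $n\le 3$, then $\mathcal{P}(\mathcal{N}_B)=\mathcal{P}(n)$. If $n\ge 4$, then $\mathcal{P}(\mathcal{N}_B)=\mathcal{P}(n)$ if and only if $B^2=0$.
   Context: $\mathbb{F}$ is an algebraically closed field of characteristic $0$. $\mathcal{P}(n)$ is the set of all partitions of $n$. For a nilpotent matrix $A$, $\mathrm{sh}(A)$ is the partition given by the sizes of the Jordan blocks of its Jordan canonical form. $\mathcal{N}_B$ is the set of all nilpotent $n\times n$ matrices commuting with $B$, and $\mathcal{P}(\mathcal{N}_B)=\{\mathrm{sh}(A):A\in\mathcal{N}_B\}$. Equivalently, $\mathcal{P}(\mathcal{N}_B)=\mathcal{P}(n)$ means that $\mathcal{N}_B$ meets every nilpotent conjugacy orbit. *)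

(* Defs.v *)
From HB Require Import structures.
From mathcomp Require Import all_boot all_order all_algebra.
Set Implicit Arguments. Unset Strict Implicit. Unset Printing Implicit Defensive.
Import GRing.Theory.
Local Open Scope ring_scope.

Definition is_partition (n : nat) (s : seq nat) : bool :=
  [&& sumn s == n, sorted geq s & all (fun x => 0 < x)%N s].

(* Positions (0-based) at which a new Jordan block starts after the first one:
   the partial sums s_1, s_1+s_2, ..., s_1+...+s_k. *)
Definition block_starts (s : seq nat) : seq nat :=
  [seq sumn (take k s) | k <- iota 1 (size s)].

(* The nilpotent Jordan matrix J_s = diag(J_{s_1}, ..., J_{s_k}), where J_m is
   the m x m nilpotent Jordan block (ones on the superdiagonal). *)
Definition jordan_nil (F : nzRingType) (n : nat) (s : seq nat) : 'M[F]_n :=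
  \matrix_(i < n, j < n)
    (((j : nat) == i.+1) && ((j : nat) \notin block_starts s))%:R.

Definition is_nilpotent (F : nzRingType) (n : nat) (A : 'M[F]_n) : Prop :=
  exists k : nat, A ^+ k = 0.

Definition has_shape (F : fieldType) (n : nat) (A : 'M[F]_n) (s : seq nat) : Prop :=
  exists P : 'M[F]_n, P \in unitmx /\ A = invmx P *m jordan_nil F n s *m P.

Definition PNB_full (F : fieldType) (n : nat) (B : 'M[F]_n) : Prop :=
  forall s : seq nat, is_partition n s ->
    exists A : 'M[F]_n,
      [/\ is_nilpotent A, A *m B = B *m A & has_shape A s].

(* Main.v *)
(* If B^2 = 0, then B is determined up to similarity by its rank, so it is enough
   to find, for every partition s of n and every r <= n/2, a square-zero matrix of
   rank r commuting with the Jordan matrix J_s: use a power of the shift on a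
   single block, and couple the blocks of odd size in pairs.

   If n = 3 and B^2 <> 0, then B is similar to J_3 and the powers of B have all shapes.

   If n >= 4, the shapes (n) and (n-1,1) alone force B^2 = 0.  A matrix commuting
   with A of shape (n) is A^k u with u invertible, so B^2 has rank n - 2k.  A
   matrix commuting with A of shape (n-1,1) is p(A) + R with A R = R A = 0 and
   R^2 = c A^(n-2); if p has order j at 0 and 2j < n-2, then B^2 has rank
   n - 1 - 2j, of the wrong parity, and if 2j >= n-2, then the rank of B is too small. *)
Require Import Defs.
From HB Require Import structures.
From mathcomp Require Import all_boot all_order all_algebra zify.
Import GRing.Theory.
Local Open Scope ring_scope.

(** * Rectangular shift matrices *)

(** On row vectors in monomial bases this is multiplication by [t^k] from F[t]/t^m to F[t]/t^n; it
    commutes with [t] when n <= m + k. *)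
Definition shift_mx {F : fieldType} (m n k : nat) : 'M[F]_(m, n) :=
  \matrix_(i < m, j < n) ((j : nat) == (i + k)%N)%:R.

(** When [i + k] falls outside [n], row [i] of the left side is zero; the hypothesis puts column i +
    k + l outside [p], so the right side vanishes too. *)
Lemma mul_shift_mx {F : fieldType} {m n p} k l :
  (p <= n + l)%N ->
  shift_mx (F := F) m n k *m shift_mx n p l = shift_mx m p (k + l).
Proof.
move=> le_p; apply/matrixP=> i j; rewrite !mxE.
have [lt_n|le_n] := ltnP (i + k) n.
  rewrite (bigD1 (Ordinal lt_n)) //= !mxE eqxx mul1r addnA big1 ?addr0 // => x.
  by rewrite !mxE -val_eqE /= => /negPf->; rewrite mul0r.
rewrite big1 => [|x _]; last first.
  by rewrite !mxE (_ : (x : nat) == _ = false) ?mul0r //; have := ltn_ord x; lia.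
by rewrite (_ : (j : nat) == _ = false) //; have := ltn_ord j; lia.
Qed.

Lemma shift_mx_eq0 {F : fieldType} m n k :
  (n <= k)%N -> shift_mx m n k = 0 :> 'M[F]_(m, n).
Proof.
move=> le_nk; apply/matrixP=> i j; rewrite !mxE (_ : (j : nat) == _ = false) //.
by have := ltn_ord j; lia.
Qed.

Lemma shift_mx0 {F : fieldType} n : shift_mx n n 0 = 1%:M :> 'M[F]_n.
Proof. by apply/matrixP=> i j; rewrite !mxE addn0 eq_sym val_eqE. Qed.

Lemma shift_mxX {F : fieldType} n k : shift_mx n n 1 ^+ k = shift_mx n n k :> 'M[F]_n.
Proof.
elim: k => [|k IHk]; first by rewrite shift_mx0.
by rewrite exprSr IHk -[LHS]/(_ *m _) mul_shift_mx ?addn1 // leq_addr.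
Qed.

Lemma row_free_shift_mx {F : fieldType} m n k :
  (m + k <= n)%N -> row_free (shift_mx (F := F) m n k).
Proof.
move=> le_n; apply/row_freeP; exists (shift_mx m n k)^T.
apply/matrixP=> i j; rewrite !mxE.
have lt_ik : (i + k < n)%N by have := ltn_ord i; lia.
rewrite (bigD1 (Ordinal lt_ik)) //= !mxE eqxx mul1r eqn_add2r big1 ?addr0 ?val_eqE //.
by move=> x; rewrite !mxE -val_eqE /= => /negPf->; rewrite mul0r.
Qed.

Lemma mxrank_shift_mx {F : fieldType} n k :
  \rank (shift_mx n n k : 'M[F]_n) = (n - k)%N.
Proof.
have [le_nk|lt_kn] := leqP n k.
  by rewrite shift_mx_eq0 // mxrank0; apply/esym/eqP; rewrite subn_eq0.
have -> : shift_mx n n k = shift_mx n (n - k) 0 *m shift_mx (n - k) n k :> 'M[F]_n.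
  by rewrite mul_shift_mx //; lia.
rewrite mxrankMfree; last by apply: row_free_shift_mx; lia.
apply/eqP/row_fullP; exists (shift_mx (n - k) n 0).
by rewrite mul_shift_mx ?shift_mx0 //; lia.
Qed.

(** * Similarity of matrices *)

(** Invertibility forces m = n, but two size expressions are allowed so that block sums need no
    casts. *)
Definition sim_mx {F : fieldType} {m n} (A : 'M[F]_m) (B : 'M[F]_n) : Prop :=
  exists P : 'M_(m, n), exists Q : 'M_(n, m),
    [/\ P *m Q = 1%:M, Q *m P = 1%:M & A *m P = P *m B].

Lemma sim_mx_refl {F : fieldType} {n} (A : 'M[F]_n) : sim_mx A A.
Proof. by exists 1%:M, 1%:M; rewrite !mulmx1 mul1mx. Qed.

Lemma sim_mx_sym {F : fieldType} {m n} {A : 'M[F]_m} {B : 'M[F]_n} :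
  sim_mx A B -> sim_mx B A.
Proof.
move=> [P [Q [PQ QP AP]]]; exists Q, P; split=> //.
by rewrite -[B *m Q]mul1mx -QP -[RHS]mulmx1 -PQ !mulmxA -(mulmxA Q A) AP !mulmxA.
Qed.

Lemma sim_mx_trans {F : fieldType} {m n p} {A : 'M[F]_m} {B : 'M[F]_n} {C : 'M[F]_p} :
  sim_mx A B -> sim_mx B C -> sim_mx A C.
Proof.
move=> [P [Q [PQ QP AP]]] [P' [Q' [PQ' QP' BP]]]; exists (P *m P'), (Q' *m Q).
split; last by rewrite mulmxA AP -mulmxA BP mulmxA.
- by rewrite mulmxA -(mulmxA P) PQ' mulmx1.
- by rewrite mulmxA -(mulmxA Q') QP mulmx1.
Qed.

Lemma sim_mx_block {F : fieldType} {m n p q} {A : 'M[F]_m} {B : 'M[F]_n}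
    {C : 'M[F]_p} {D : 'M[F]_q} :
  sim_mx A B -> sim_mx C D -> sim_mx (block_mx A 0 0 C) (block_mx B 0 0 D).
Proof.
move=> [P [Q [PQ QP AP]]] [P' [Q' [PQ' QP' CP]]].
exists (block_mx P 0 0 P'), (block_mx Q 0 0 Q').
by rewrite !mulmx_block !mulmx0 !mul0mx !addr0 !add0r PQ QP PQ' QP' AP CP -!scalar_mx_block.
Qed.

Lemma sim_mx_blockC {F : fieldType} {m n} (A : 'M[F]_m) (B : 'M[F]_n) :
  sim_mx (block_mx A 0 0 B) (block_mx B 0 0 A).
Proof.
exists (block_mx 0 1%:M 1%:M 0), (block_mx 0 1%:M 1%:M 0).
by rewrite !mulmx_block !mulmx0 !mul0mx !mulmx1 !mul1mx !addr0 !add0r -!scalar_mx_block.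
Qed.

Lemma sim_mxX {F : fieldType} {m n} {A : 'M[F]_m} {B : 'M[F]_n} k :
  sim_mx A B -> sim_mx (A ^+ k) (B ^+ k).
Proof.
move=> [P [Q [PQ QP AP]]]; exists P, Q; split=> //.
elim: k => [|k IHk]; first by rewrite mul1mx mulmx1.
rewrite !exprSr -[A ^+ k * A]/(_ *m _) -[B ^+ k * B]/(_ *m _).
by rewrite -mulmxA AP mulmxA IHk mulmxA.
Qed.

Lemma sim_mx_rank {F : fieldType} {m n} {A : 'M[F]_m} {B : 'M[F]_n} :
  sim_mx A B -> \rank A = \rank B.
Proof.
move=> [P [Q [PQ QP AP]]].
have fP : row_free P by apply/row_freeP; exists Q.
have uP : row_full P by apply/row_fullP; exists Q.
by rewrite -(mxrankMfree A fP) AP eqmxMfull.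
Qed.

Lemma sim_mx_comm {F : fieldType} {m n} {A : 'M[F]_m} {B C : 'M[F]_n} :
  sim_mx A B -> C *m B = B *m C -> exists2 D, D *m A = A *m D & sim_mx D C.
Proof.
move=> [P [Q [PQ QP AP]]] CB; exists (P *m C *m Q).
  have QA : Q *m A = B *m Q.
    by rewrite -[B *m Q]mul1mx -QP -[LHS]mulmx1 -PQ !mulmxA -(mulmxA Q A) AP !mulmxA.
  by rewrite !mulmxA AP -(mulmxA P B) -CB -(mulmxA _ Q) QA !mulmxA.
by exists P, Q; split; rewrite // -mulmxA QP mulmx1.
Qed.

Lemma has_shapeP {F : fieldType} {n} {A : 'M[F]_n} {s} :
  has_shape A s <-> sim_mx A (jordan_nil F n s).
Proof.
split=> [[P [uP ->]]|[P [Q [PQ QP AP]]]].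
  by exists (invmx P), P; rewrite mulmxV // mulVmx // -!mulmxA mulmxV // mulmx1.
have uQ : Q \in unitmx by case: (mulmx1_unit PQ).
exists Q; split=> //; have -> : invmx Q = P by rewrite -[invmx Q]mul1mx -PQ mulmxK.
by rewrite -AP -mulmxA PQ mulmx1.
Qed.

(** * Nilpotent Jordan matrices: block sums and reordering of blocks *)

(** The k-th power vanishes strictly below its k-th superdiagonal. *)
Lemma jordan_nil_nilp {F : fieldType} n s : jordan_nil F n s ^+ n = 0.
Proof.
have E k (i j : 'I_n) : (j < i + k)%N -> (jordan_nil F n s ^+ k) i j = 0.
  elim: k i j => [|k IHk] i j lt_j.
    by rewrite expr0 mxE -val_eqE gtn_eqF //=; lia.
  rewrite exprSr mxE big1 // => x _.
  have [lt_x|le_x] := ltnP x (i + k); first by rewrite IHk ?mul0r.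
  by rewrite !mxE ltn_eqF ?mulr0 //; lia.
by apply/matrixP=> i j; rewrite E ?mxE //; have := ltn_ord j; lia.
Qed.

Lemma jordan_nil1 {F : fieldType} n : jordan_nil F n [:: n] = shift_mx n n 1.
Proof.
apply/matrixP=> i j; rewrite !mxE /block_starts /= inE addn0 addn1.
by rewrite (ltn_eqF (ltn_ord j)) andbT.
Qed.

Lemma block_starts_cat s1 s2 :
  block_starts (s1 ++ s2) = block_starts s1 ++ [seq (sumn s1 + x)%N | x <- block_starts s2].
Proof.
rewrite /block_starts size_cat iotaD map_cat; congr (_ ++ _).
  by apply/eq_in_map=> k; rewrite mem_iota => lek; rewrite takel_cat //; lia.
rewrite -map_comp addnC iotaDl -map_comp; apply/eq_map => k /=.
by rewrite take_cat ltnNge leq_addr /= addKn sumn_cat.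
Qed.

(** Once the size is rewritten as a sum the two matrices are equal: the only superdiagonal entry
    outside the diagonal blocks lies in column [sumn s1], which is a block start. *)
Lemma jordan_nil_cat {F : fieldType} s1 s2 :
  sim_mx (jordan_nil F (sumn (s1 ++ s2)) (s1 ++ s2))
    (block_mx (jordan_nil F (sumn s1) s1) 0 0 (jordan_nil F (sumn s2) s2)).
Proof.
rewrite sumn_cat.
suff -> : jordan_nil F (sumn s1 + sumn s2) (s1 ++ s2) =
  block_mx (jordan_nil F (sumn s1) s1) 0 0 (jordan_nil F (sumn s2) s2).
  exact: sim_mx_refl.
have le_s k : (sumn (take k s1) <= sumn s1)%N.
  by rewrite -{2}(cat_take_drop k s1) sumn_cat leq_addr.
have le1 x : x \in block_starts s1 -> (x <= sumn s1)%N by case/mapP=> k _ ->.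
apply/matrixP=> i j; rewrite !mxE; case: splitP => i' ->; rewrite !mxE;
  case: splitP => j' ->; rewrite !mxE block_starts_cat mem_cat negb_or.
- congr (_ && _)%:R; rewrite andbC [X in X && _](_ : _ = true) //.
  by apply/mapP=> -[x _]; have := ltn_ord j'; lia.
- case: eqP => //= E; have -> : (sumn s1 + j' = sumn s1)%N by have := ltn_ord i'; lia.
  suff -> : sumn s1 \in block_starts s1 by [].
  apply/mapP; exists (size s1); rewrite ?take_size // mem_iota add1n ltnSn andbT lt0n.
  by case: s1 i' {le_s le1 i j E} => // -[].
- by rewrite (_ : (j' : nat) == _ = false) //; have := ltn_ord j'; lia.
- rewrite -addnS eqn_add2l; case: eqP => //= ->.
  rewrite [X in X && _](_ : _ = true) /=; last by apply/negP=> /le1; lia.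
  by rewrite mem_map //; apply: addnI.
Qed.

(** This allows two odd parts that are not adjacent in a partition to be brought together. *)
Lemma jordan_nil_perm {F : fieldType} s1 s2 : perm_eq s1 s2 ->
  sim_mx (jordan_nil F (sumn s1) s1) (jordan_nil F (sumn s2) s2).
Proof.
have cong (t1 t2 t : seq nat) :
    sim_mx (jordan_nil F (sumn t1) t1) (jordan_nil F (sumn t2) t2) ->
    sim_mx (jordan_nil F (sumn (t1 ++ t)) (t1 ++ t))
      (jordan_nil F (sumn (t2 ++ t)) (t2 ++ t)).
  move=> t12; apply: sim_mx_trans (jordan_nil_cat _ _) _.
  apply: sim_mx_trans (sim_mx_block t12 (sim_mx_refl _)) _.
  exact/sim_mx_sym/jordan_nil_cat.
have swap t1 t2 : sim_mx (jordan_nil F (sumn (t1 ++ t2)) (t1 ++ t2))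
    (jordan_nil F (sumn (t2 ++ t1)) (t2 ++ t1)).
  apply: sim_mx_trans (jordan_nil_cat _ _) _.
  by apply: sim_mx_trans (sim_mx_blockC _ _) _; apply/sim_mx_sym/jordan_nil_cat.
elim: s1 s2 => [|x s1 IHs] s2 s12.
  by rewrite perm_sym in s12; rewrite (perm_small_eq _ s12) //; apply: sim_mx_refl.
have /splitPr x_s2 : x \in s2 by rewrite -(perm_mem s12) mem_head.
case: x_s2 s12 => p1 p2 /perm_trans/(_ (permEl (perm_catCA p1 [:: x] p2))).
rewrite /= perm_cons => /IHs s12.
apply: sim_mx_trans (swap [:: x] s1) (sim_mx_trans (cong _ _ [:: x] s12) _).
rewrite -catA; apply: sim_mx_trans (swap _ _) _.
exact: sim_mx_trans (cong _ _ p1 (swap p2 [:: x])) (swap _ _).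
Qed.

(** * Square-zero matrices of prescribed rank commuting with a Jordan matrix *)

(** Asking for [A] only up to similarity, in a free size, makes the property stable under block sums
    and reordering. *)
Definition jordan_sq0 (F : fieldType) (s : seq nat) (r : nat) : Prop :=
  exists n, exists A : 'M[F]_n, exists B : 'M[F]_n,
    [/\ sim_mx A (jordan_nil F (sumn s) s), A *m B = B *m A, B *m B = 0 & \rank B = r].

Lemma jordan_sq0_perm {F : fieldType} {s1 s2 r} :
  perm_eq s1 s2 -> jordan_sq0 F s1 r -> jordan_sq0 F s2 r.
Proof.
move=> s12 [n [A [B [simA AB BB rB]]]]; exists n, A, B; split=> //.
exact: sim_mx_trans simA (jordan_nil_perm _ _ s12).
Qed.

Lemma jordan_sq0_cat {F : fieldType} s1 s2 r1 r2 :
  jordan_sq0 F s1 r1 -> jordan_sq0 F s2 r2 -> jordan_sq0 F (s1 ++ s2) (r1 + r2).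
Proof.
move=> [n1 [A1 [B1 [simA1 AB1 BB1 rB1]]]] [n2 [A2 [B2 [simA2 AB2 BB2 rB2]]]].
exists (n1 + n2)%N, (block_mx A1 0 0 A2), (block_mx B1 0 0 B2); split.
- by apply: sim_mx_trans (sim_mx_block simA1 simA2) _; apply/sim_mx_sym/jordan_nil_cat.
- by rewrite !mulmx_block !mulmx0 !mul0mx !addr0 !add0r AB1 AB2.
- by rewrite !mulmx_block !mulmx0 !mul0mx !addr0 !add0r BB1 BB2 block_mx_const.
- by rewrite rank_diag_block_mx rB1 rB2.
Qed.

(** Take B = X Y, a surjection onto F^r followed by an injection, both intertwining [A] with [N];
    then B^2 = X (Y X) Y = 0. *)
Lemma sq0_of_factors {F : fieldType} {n r} {A : 'M[F]_n} {N : 'M[F]_r}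
    {X : 'M[F]_(n, r)} {Y : 'M[F]_(r, n)} :
    row_full X -> row_free Y -> A *m X = X *m N -> N *m Y = Y *m A -> Y *m X = 0 ->
  exists B : 'M[F]_n, [/\ A *m B = B *m A, B *m B = 0 & \rank B = r].
Proof.
move=> uX fY AX NY YX0; exists (X *m Y); split.
- by rewrite mulmxA AX -!mulmxA NY.
- by rewrite mulmxA -(mulmxA X) YX0 mulmx0 mul0mx.
- by rewrite mxrankMfree //; apply/eqP.
Qed.

(** Multiplication by t^(m-r) on F[t]/t^m, factored through F[t]/t^r; its square is zero because
    2(m-r) >= m. *)
Lemma jordan_sq0_single {F : fieldType} m r : (r.*2 <= m)%N -> jordan_sq0 F [:: m] r.
Proof.
move=> le_r.
have [|||||B [AB BB rB]] := @sq0_of_factors F m r (shift_mx m m 1) (shift_mx r r 1)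
  (shift_mx m r 0) (shift_mx r m (m - r)).
- apply/row_fullP; exists (shift_mx r m 0).
  by rewrite mul_shift_mx ?shift_mx0 //; lia.
- by apply: row_free_shift_mx; lia.
- by rewrite !mul_shift_mx ?addn0 ?add0n //; lia.
- by rewrite !mul_shift_mx 1?addnC //; lia.
- by rewrite mul_shift_mx ?shift_mx_eq0 //; lia.
exists m, (shift_mx m m 1), B; split=> //.
by rewrite -jordan_nil1 /= addn0; apply: sim_mx_refl.
Qed.

(* On F[t]/t^(m+2d) + F[t]/t^m with generators e, f, put v = t^d e + f; then
   e |-> v, f |-> - t^d v commutes with t, has square zero and rank m + d.
   Multiplying it by t^(m+d-r) lowers the rank to r. *)
Lemma jordan_sq0_pair {F : fieldType} m d r :
  (r <= m + d)%N -> jordan_sq0 F [:: (m + d.*2)%N; m] r.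
Proof.
move=> le_r; set m1 := (m + d.*2)%N; pose k := (m + d - r)%N.
have [|||||B [AB BB rB]] := @sq0_of_factors F (m1 + m) r
  (block_mx (shift_mx m1 m1 1) 0 0 (shift_mx m m 1)) (shift_mx r r 1)
  (col_mx (shift_mx m1 r 0) (- shift_mx m r d))
  (row_mx (shift_mx r m1 (d + k)) (shift_mx r m k)).
- apply/row_fullP; exists (row_mx (shift_mx r m1 0) 0).
  by rewrite mul_row_col mul0mx addr0 mul_shift_mx ?shift_mx0 //; lia.
- have /row_freeP[Z YZ] : row_free (shift_mx (F := F) r m1 (d + k)).
    by apply: row_free_shift_mx; lia.
  by apply/row_freeP; exists (col_mx Z 0); rewrite mul_row_col mulmx0 addr0.
- rewrite mul_block_col !mul0mx addr0 add0r mul_col_mx mulmxN mulNmx.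
  by rewrite !mul_shift_mx ?addn0 ?add0n 1?(addnC 1%N) //; lia.
- rewrite mul_row_block !mulmx0 addr0 add0r mul_mx_row.
  by rewrite !mul_shift_mx 1?(addnC 1%N (d + k)%N) 1?(addnC 1%N k) //; lia.
- rewrite mul_row_col mulmxN !mul_shift_mx; [|lia|lia].
  by rewrite addn0 addnC subrr.
exists (m1 + m)%N, (block_mx (shift_mx m1 m1 1) 0 0 (shift_mx m m 1)), B; split=> //.
rewrite -!jordan_nil1; have := jordan_nil_cat (F := F) [:: m1] [:: m].
by rewrite /= !addn0 => /sim_mx_sym.
Qed.

Lemma sumn_even s : ~~ has odd s -> ~~ odd (sumn s).
Proof. by elim: s => //= x s IHs /norP[x_even /IHs]; rewrite oddD (negPf x_even). Qed.

(** Greedy induction on the number of parts: an even part [x] carries rank up to x/2 and a pair of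
    odd parts up to (x+y)/2, so a half is lost only at a last unpaired odd part. *)
Lemma jordan_sq0_exists {F : fieldType} s r : (r.*2 <= sumn s)%N -> jordan_sq0 F s r.
Proof.
have [N] := ubnP (size s); elim: N s r => // N IHN [|x s] r /= le_s le_r.
  exists 0%N, 0, 0; rewrite mulmx0 mxrank0; split=> //; last by lia.
  by rewrite (_ : jordan_nil _ _ _ = 0) ?flatmx0 //; apply: sim_mx_refl.
(* If [x] is treated alone, either [x] is even or the remaining sum is even, so rounding down x/2
   leaves enough room for the rest of the rank. *)
have [/andP[odd_x /hasP[y y_s odd_y]]|nodd] := boolP (odd x && has odd s); last first.
  have -> : r = (minn r x./2 + (r - minn r x./2))%N by lia.
  apply: (jordan_sq0_cat [:: x]); first by apply: jordan_sq0_single; lia.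
  apply: IHN; first by lia.
  by case: (boolP (odd x)) nodd => /= [odd_x /sumn_even|]; lia.
have perm_s := perm_to_rem y_s; have sum_s := perm_sumn perm_s.
have size_s := perm_size perm_s; rewrite /= in sum_s size_s.
apply: (@jordan_sq0_perm _ ([:: x; y] ++ rem y s)).
  by rewrite /= perm_cons perm_sym.
have -> : r = (minn r (x + y)./2 + (r - minn r (x + y)./2))%N by lia.
apply: jordan_sq0_cat; last by apply: IHN; lia.
wlog le_yx : x y odd_x odd_y {le_s le_r y_s perm_s sum_s size_s} / (y <= x)%N => [IH|].
  have [/IH|/ltnW/IH] := leqP y x; first exact.
  by rewrite addnC => /(_ odd_y odd_x); apply: jordan_sq0_perm; rewrite (perm_catC [:: y] [:: x]).
have -> : x = (y + ((x - y)./2).*2)%N by lia.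
by apply: jordan_sq0_pair; lia.
Qed.

(** * Square-zero matrices up to similarity, and the case of square zero *)

(* With [U] a basis of the image, [V] preimages of [U] and [C] a basis of a complement
   of the image in the kernel, the rows of [V], [U], [C] form a basis. *)
Lemma sq0_normal_form {F : fieldType} {n r c : nat} {B : 'M[F]_n} :
  B *m B = 0 -> \rank B = r -> (r + r + c)%N = n ->
  sim_mx B (block_mx (block_mx 0 (1%:M : 'M_r) 0 0) 0 0 (0 : 'M_c)).
Proof.
move=> BB rB def_n; have sBK : (B <= kermx B)%MS by apply/sub_kermxP.
have [U [fU UB]] : exists U : 'M_(r, n), row_free U /\ (U :=: B)%MS.
  by rewrite -rB; exists (row_base B); split; [apply: row_base_free|apply: eq_row_base].
have [V def_U] : exists V : 'M_(r, n), U = V *m B by apply/submxP; rewrite UB.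
have rD : \rank (kermx B :\: U) = c.
  have := mxrank_cap_compl (kermx B) U; rewrite mxrank_ker rB.
  by rewrite (capmx_idPr _) ?UB // rB; lia.
have [C CD] : exists C : 'M_(c, n), (C :=: (kermx B :\: U)%MS)%MS.
  by rewrite -rD; exists (row_base (kermx B :\: U)%MS); apply: eq_row_base.
have CB : C *m B = 0 by apply/sub_kermxP; rewrite CD diffmxSl.
have UB0 : U *m B = 0 by apply/sub_kermxP; rewrite UB.
pose P := col_mx (col_mx V U) C.
have PB : P *m B = col_mx (col_mx U 0) 0 by rewrite !mul_col_mx CB UB0 -def_U.
have rP : \rank P = n.
  (* Rank-nullity for [B] on the row space of [P]: the image contains [U], of rank r, and the row
     space contains the whole kernel, of dimension n - r. *)
  apply/eqP; rewrite eqn_leq rank_leq_col -(mxrank_mul_ker P B).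
  have le1 : (r <= \rank (P *m B))%N.
    rewrite PB; apply: leq_trans (_ : \rank U <= _)%N; first by rewrite (eqP fU).
    apply: mxrankS.
    by rewrite -addsmxE (submx_trans _ (addsmxSl _ _)) // -addsmxE addsmxSl.
  have : (\rank (kermx B) <= \rank (P :&: kermx B))%N.
    apply: mxrankS; rewrite sub_capmx submx_refl andbT.
    rewrite -(addsmx_diff_cap_eq (kermx B) U) -addsmxE addsmx_sub -CD addsmxSr.
    rewrite (submx_trans (capmxSr _ _)) // (submx_trans _ (addsmxSl _ _)) //.
    by rewrite -addsmxE addsmxSr.
  by rewrite mxrank_ker rB; lia.
have /row_freeP[Q PQ] : row_free P by rewrite /row_free rP def_n.
have /row_fullP[Q' QP] : row_full P by rewrite /row_full rP.
have eqQ : Q' = Q by rewrite -[Q']mulmx1 -PQ mulmxA QP mul1mx.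
apply: sim_mx_sym; exists P, Q; rewrite PQ -eqQ QP PB; split=> //.
by rewrite /P !mul_block_col !mul0mx mul1mx !addr0 add0r.
Qed.

Lemma sim_mx_nilp {F : fieldType} {m n} {A : 'M[F]_m} {B : 'M[F]_n} :
  sim_mx A B -> is_nilpotent B -> is_nilpotent A.
Proof.
move=> AB [k Bk]; exists k; apply/eqP.
by rewrite -mxrank_eq0 (sim_mx_rank (sim_mxX k AB)) Bk mxrank0.
Qed.

Lemma sq0_PNB_full {F : fieldType} {n} {B : 'M[F]_n} : B *m B = 0 -> PNB_full B.
Proof.
move=> BB s /and3P[/eqP sum_s _ _]; subst n; have le_r := mulmx0_rank_max BB.
have [|n0 [A0 [B0 [/sim_mx_sym simA AB BB0 rB0]]]] := @jordan_sq0_exists F s (\rank B).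
  by lia.
(* [B1] commutes with the Jordan matrix itself. It has square zero and the rank of [B], hence is
   similar to [B], and the Jordan matrix is then carried along this similarity. *)
have [B1 comB1 simB1] := sim_mx_comm simA (esym AB).
have BB1 : B1 *m B1 = 0.
  have [P [Q [PQ QP BP]]] := simB1.
  by rewrite -[B1 *m B1]mulmx1 -PQ mulmxA -(mulmxA B1) BP mulmxA BP -(mulmxA P) BB0 mulmx0 mul0mx.
have rB1 : \rank B1 = \rank B by rewrite (sim_mx_rank simB1).
have def_n : (\rank B + \rank B + (sumn s - (\rank B).*2))%N = sumn s by lia.
have simBB1 := sim_mx_trans (sq0_normal_form BB erefl def_n)
  (sim_mx_sym (sq0_normal_form BB1 rB1 def_n)).
have [A comA simA'] := sim_mx_comm simBB1 (esym comB1).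
exists A; split=> //; last exact/has_shapeP.
by apply: sim_mx_nilp simA' _; exists (sumn s); apply: jordan_nil_nilp.
Qed.

(** * Nilpotent matrices of maximal index, and sizes up to 3 *)

(** The minimal polynomial divides a power of X, so it is X^d up to a scalar; dividing the
    characteristic polynomial, it has d <= n. *)
Lemma nilp_exp_size {F : fieldType} {n} {B : 'M[F]_n} : is_nilpotent B -> B ^+ n = 0.
Proof.
case: n B => [|n] B [k Bk]; first by rewrite [LHS]flatmx0.
have minB : mxminpoly B %| ('X - 0%:P) ^+ k.
  by apply: mxminpoly_min; rewrite subr0 rmorphXn /= horner_mx_X.
have [d _ eq_d] := dvdp_exp_XsubCP minB.
have : (size (mxminpoly B) <= n.+2)%N.
  by rewrite -(size_char_poly B) dvdp_leq ?monic_neq0 ?char_poly_monic ?mxminpoly_dvd_char.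
rewrite (eqp_size eq_d) size_exp_XsubC ltnS => le_d.
have /mxminpoly_minP : mxminpoly B %| ('X - 0%:P) ^+ d by rewrite (eqp_dvdl _ eq_d).
rewrite subr0 rmorphXn /= horner_mx_X => Bd.
have -> : B ^+ n.+1 = B ^+ (n.+1 - d) * B ^+ d by rewrite -exprD subnK.
by rewrite Bd mulr0.
Qed.

(** A row vector [e] with e B^n nonzero is cyclic: the rows e B^k form a basis on which [B] acts as
    the shift. *)
Lemma nilp_regular {F : fieldType} {n} {B : 'M[F]_n.+1} :
  is_nilpotent B -> B ^+ n != 0 -> sim_mx B (shift_mx n.+1 n.+1 1).
Proof.
move=> nilB /rowV0Pn[_ /submxP[e ->] eBn].
have B0 k : (n < k)%N -> B ^+ k = 0.
  move=> lt_k; have -> : B ^+ k = B ^+ (k - n.+1) * B ^+ n.+1 by rewrite -exprD subnK.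
  by rewrite (nilp_exp_size nilB) mulr0.
pose P := \matrix_(k < n.+1) (e *m B ^+ k).
have PB : P *m B = shift_mx n.+1 n.+1 1 *m P.
  apply/row_matrixP=> k; rewrite !row_mul rowK -mulmxA -[B ^+ k *m B]exprSr.
  have [lt_k|le_k] := ltnP k n.
    have -> : row k (shift_mx n.+1 n.+1 1) = delta_mx 0 (inord k.+1) :> 'rV[F]_n.+1.
      by apply/rowP=> j; rewrite !mxE /= addn1 -val_eqE /= inordK // ltnS.
    by rewrite -rowE rowK inordK.
  rewrite B0 ?ltnS // mulmx0; have -> : row k (shift_mx n.+1 n.+1 1) = 0 :> 'rV[F]_n.+1.
    apply/rowP=> j; rewrite !mxE (_ : (j : nat) == _ = false) //.
    by have := ltn_ord j; lia.
  by rewrite mul0mx.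
have fP : row_free P.
  rewrite -kermx_eq0; apply/rowV0P=> v /sub_kermxP vP0; apply/rowP=> j; rewrite mxE.
  have [k] := ubnP (j : nat); elim: k j => // k IHk j; rewrite ltnS => le_j.
  (* Multiplying the relation by B^(n-j) kills the terms of index above [j]; those below vanish by
     induction, which isolates the coefficient of e B^n. *)
  have := congr1 (mulmx^~ (B ^+ (n - j))) vP0.
  rewrite /= mul0mx (mulmx_sum_row v) mulmx_suml.
  rewrite (bigD1 j) //= big1 ?addr0 => [|i];
    rewrite rowK -scalemxAl -mulmxA -[B ^+ _ *m B ^+ _]exprD.
    rewrite subnKC -1?ltnS // => /eqP; rewrite scaler_eq0 (negPf eBn) orbF.
    by move/eqP.
  rewrite -val_eqE /= neq_ltn => /orP[lt_ij|lt_ji].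
    by rewrite (IHk i) ?scale0r // (leq_trans lt_ij).
  by rewrite B0 ?mulmx0 ?scaler0 //; have := ltn_ord j; lia.
have uP : P \in unitmx by rewrite -row_free_unit.
apply: sim_mx_sym; exists P, (invmx P); split; [exact: mulmxV|exact: mulVmx|by []].
Qed.

Lemma small_PNB_full {F : fieldType} {n} {B : 'M[F]_n} :
  (n <= 3)%N -> is_nilpotent B -> PNB_full B.
Proof.
move=> le_n nilB; have [BB|BB] := eqVneq (B *m B) 0; first exact: sq0_PNB_full.
have Bn := nilp_exp_size nilB.
have eq_n : n = 3%N.
  case: n le_n B BB Bn {nilB} => [|[|[|[]]]] //= _ B.
  - by rewrite [B *m B]flatmx0 eqxx.
  - by rewrite expr1 => /[swap] ->; rewrite mulmx0 eqxx.
  - by rewrite -[B *m B]/(B ^+ 2) => /[swap] ->; rewrite eqxx.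
subst n; have simB := nilp_regular nilB BB.
have nilX k : is_nilpotent (B ^+ k.+1).
  by exists 3%N; rewrite -exprM mulnC exprM Bn expr0n.
move=> s part_s.
have : s \in [:: [:: 3]; [:: 2; 1]; [:: 1; 1; 1]]%N.
  move: part_s; rewrite /is_partition; case: s => [|a [|b [|c [|d s]]]] //=.
  - by rewrite addn0 => /andP[/eqP->].
  - rewrite addn0 !andbT => /and3P[/eqP]; rewrite !inE => abE le_ba /andP[a0 b0].
    by have [-> ->] : a = 2%N /\ b = 1%N by lia.
  - rewrite addn0 !andbT => /and3P[/eqP abE _] /and3P[a0 b0 c0].
    by have [-> [-> ->]] : a = 1%N /\ b = 1%N /\ c = 1%N by lia.
  - by case/and3P=> /eqP abE _ /and5P[a0 b0 c0 d0 _]; lia.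
rewrite !inE => /or3P[] /eqP->.
- exists B; split=> //; apply/has_shapeP; rewrite jordan_nil1; exact: simB.
- exists (B ^+ 2); split; [exact: nilX | by rewrite expr2 mulmxA |].
  apply/has_shapeP; apply: sim_mx_trans (sim_mxX 2 simB) _; rewrite shift_mxX.
  (* The transposition of the indices 1 and 2: it turns the single arrow 0 -> 2 of the squared shift
     into the arrow 0 -> 1. *)
  pose T : 'M[F]_3 := \matrix_(i < 3, j < 3) ((j : nat) == (i.*2 %% 3)%N)%:R.
  have TT : T *m T = 1%:M.
    apply/matrixP=> i j; rewrite !mxE !big_ord_recl big_ord0 !mxE.
    by case: i => -[|[|[]]] //= i; case: j => -[|[|[]]] //= j;
      rewrite ?mul0r ?mul1r ?addr0 ?add0r.
  exists T, T; split=> //; apply/matrixP=> i j.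
  rewrite !mxE !big_ord_recl !big_ord0 !mxE.
  by case: i => -[|[|[]]] //= i; case: j => -[|[|[]]] //= j;
    rewrite ?mul0r ?mul1r ?addr0 ?add0r.
- exists 0; rewrite mulmx0 mul0mx; split=> //; first by exists 1%N; rewrite expr1.
  apply/has_shapeP; rewrite (_ : jordan_nil _ _ _ = 0); first exact: sim_mx_refl.
  apply/matrixP=> i j; rewrite !mxE; case: eqP => //= ->.
  by case: i => -[|[|[]]].
Qed.

(** * Ranks in the commutants of Jordan matrices of shapes (n) and (n-1,1) *)

(** A Bezout relation between [u] and X^m, where A^m = 0, makes u(A) invertible. *)
Lemma nilp_horner_rank {F : fieldType} {n} {A : 'M[F]_n.+1} {u : {poly F}} {k} :
  is_nilpotent A -> ~~ root u 0 -> \rank (horner_mx A (u * 'X^k)) = \rank (A ^+ k).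
Proof.
move=> [m Am] u0; rewrite rmorphM rmorphXn /= horner_mx_X.
have /Bezout_coprimepP[[a b] /= /eqp_size] : coprimep u ('X ^+ m).
  by apply: coprimep_expr; rewrite coprimepX.
rewrite size_poly1 => /eqP/size_poly1P[c c0 abE].
have uU : horner_mx A u \in unitmx.
  suff /mulmx1_unit[_ //] : (c^-1 *: horner_mx A a) *m horner_mx A u = 1%:M.
  rewrite -scalemxAl -[horner_mx A a *m _]rmorphM /=.
  have -> : a * u = c%:P - b * 'X^m by rewrite -abE addrK.
  rewrite rmorphB rmorphM rmorphXn /= horner_mx_X Am mulr0 subr0 horner_mx_C.
  by rewrite scale_scalar_mx mulVf.
by rewrite -mulmxE eqmxMfull // row_full_unit.
Qed.

Lemma mul_horner_poly {F : fieldType} {n m} (v : 'rV[F]_n.+1) (A : 'M[F]_n.+1) (c : nat -> F) :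
  v *m horner_mx A (\poly_(i < m) c i) = \sum_(i < m) c i *: (v *m A ^+ i).
Proof.
rewrite poly_def rmorph_sum mulmx_sumr; apply: eq_bigr => i _.
by rewrite -mul_polyC rmorphM rmorphXn /= horner_mx_C horner_mx_X -mulmxE mul_scalar_mx scalemxAr.
Qed.

(** The first basis vector is cyclic for the shift, so row 0 of [B] gives the coefficients of a
    polynomial p with B = p(A); [k] is the order of p at 0. *)
Lemma comm_regular_rank {F : fieldType} {n} {B : 'M[F]_n.+1} :
    B *m shift_mx n.+1 n.+1 1 = shift_mx n.+1 n.+1 1 *m B ->
  exists k, \rank B = (n.+1 - k)%N /\ \rank (B *m B) = (n.+1 - k.*2)%N.
Proof.
set A := shift_mx _ _ _ => BA.
have nilA : is_nilpotent A by exists n.+1; rewrite shift_mxX shift_mx_eq0.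
have eA (i : 'I_n.+1) : delta_mx 0 0 *m A ^+ i = delta_mx 0 i :> 'rV[F]_n.+1.
  rewrite shift_mxX -rowE; apply/rowP=> j.
  by rewrite !mxE /= add0n -val_eqE.
have BX i : B *m A ^+ i = A ^+ i *m B by apply: commrX.
pose p := \poly_(i < n.+1) B 0 (inord i).
have defB : B = horner_mx A p.
  apply/row_matrixP=> i; rewrite !rowE -eA.
  have comp : horner_mx A p *m A ^+ i = A ^+ i *m horner_mx A p.
    by apply: comm_horner_mx; apply: commrX.
  rewrite -!mulmxA -BX -comp !mulmxA; congr (_ *m _).
  rewrite mul_horner_poly -rowE [LHS]row_sum_delta; apply: eq_bigr => j _.
  by rewrite eA mxE inord_val.
have [pA0|pA0] := eqVneq p 0.
  by exists n.+1; rewrite defB pA0 rmorph0 mulmx0 mxrank0; split; lia.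
have [k [u /implyP/(_ pA0) u0 p_eq]] := multiplicity_XsubC p 0.
rewrite subr0 in p_eq.
exists k; rewrite -[B *m B]/(B * B) defB -rmorphM /= p_eq; split.
  by rewrite nilp_horner_rank // shift_mxX mxrank_shift_mx.
rewrite mulrACA -exprD addnn nilp_horner_rank ?shift_mxX ?mxrank_shift_mx //.
by rewrite rootM negb_or u0.
Qed.

Lemma nilp_eigen {F : fieldType} {n} {B : 'M[F]_n} {v : 'rV_n} {c : F} :
  is_nilpotent B -> v != 0 -> v *m B = c *: v -> c = 0.
Proof.
move=> [k Bk] v0 vB; have E i : v *m B ^+ i = c ^+ i *: v.
  elim: i => [|i IHi]; first by rewrite mulmx1 scale1r.
  by rewrite exprSr -[B ^+ i * B]/(_ *m _) mulmxA IHi -scalemxAl vB scalerA -exprSr.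
have /eqP := E k; rewrite Bk mulmx0 eq_sym scaler_eq0 (negPf v0) orbF.
by rewrite expf_eq0 => /andP[_ /eqP].
Qed.

Lemma jordan_nil_subE {F : fieldType} N (i j : 'I_N.+2) :
  jordan_nil F N.+2 [:: N.+1; 1%N] i j = (((j : nat) == i.+1) && (i < N)%N)%:R.
Proof.
rewrite mxE /block_starts /= !inE addn0 addn1.
by congr (nat_of_bool _)%:R; have := ltn_ord i; have := ltn_ord j; lia.
Qed.

(** The exponent is kept positive because the block of size 1 contributes to the rank of the zeroth
    power. *)
Lemma mxrank_jordan_nil_sub {F : fieldType} N m :
  \rank (jordan_nil F N.+2 [:: N.+1; 1%N] ^+ m.+1) = (N - m)%N.
Proof.
have -> : N.+2 = sumn [:: N.+1; 1%N] by rewrite /= addn1.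
rewrite (sim_mx_rank (sim_mxX m.+1 (jordan_nil_cat [:: N.+1] [:: 1%N]))).
rewrite (_ : jordan_nil F (sumn [:: 1%N]) _ = 0); last first.
  by apply/matrixP=> i j; rewrite !mxE; have := ltn_ord j; have := ltn_ord i;
    case: eqP => //=; lia.
have -> : forall n p (A : 'M[F]_n), block_mx A 0 0 (0 : 'M_p) ^+ m.+1 =
    block_mx (A ^+ m.+1) 0 0 0.
  move=> n p A; elim: m => // m IHm; rewrite exprS IHm -[LHS]/(_ *m _) mulmx_block.
  by rewrite !mulmx0 !mul0mx !addr0 -[A ^+ m.+2]/(A * _).
rewrite rank_diag_block_mx mxrank0 addn0.
have -> : sumn [:: N.+1] = N.+1 by rewrite /= addn0.
by rewrite jordan_nil1 shift_mxX mxrank_shift_mx subSS.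
Qed.

(* Modulo polynomials in [A], an endomorphism [B] commuting with [A] is a map [R]
   killed by [A] on both sides, so that [B^2 = p(A)^2 + c A^N] where [A^(N+1) = 0]. *)
Lemma comm_subregular_rank {F : fieldType} {N} {B : 'M[F]_N.+2} :
    let A := jordan_nil F N.+2 [:: N.+1; 1%N] in
    (0 < N)%N -> is_nilpotent B -> B *m A = A *m B ->
  exists j, [/\ (0 < j)%N,
    (j.*2 < N)%N -> \rank (B *m B) = (N.+1 - j.*2)%N,
    (N <= j.*2)%N -> (\rank (B *m B) <= 1)%N,
    (j < N)%N -> (\rank B <= N.+1 - j)%N &
    (N <= j)%N -> (\rank B <= 2)%N].
Proof.
(* [e] generates the block of size N + 1 and [f] spans the block of size 1. *)
move=> A N0 nilB BA; pose e : 'rV[F]_N.+2 := delta_mx 0 0.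
pose f : 'rV[F]_N.+2 := delta_mx 0 ord_max.
have AE : forall i j, A i j = _ := jordan_nil_subE N.
have AN1 : A ^+ N.+1 = 0.
  by apply/eqP; rewrite -mxrank_eq0 mxrank_jordan_nil_sub subnn.
have nilA : is_nilpotent A by exists N.+1.
have fA : f *m A = 0.
  by rewrite -rowE; apply/rowP=> j; rewrite [LHS]mxE AE mxE ltnNge leqnSn andbF.
have fAk k : (0 < k)%N -> f *m A ^+ k = 0.
  by case: k => // k _; rewrite exprS -[A * _]/(A *m _) mulmxA fA mul0mx.
have eA i : (i <= N)%N -> e *m A ^+ i = delta_mx 0 (inord i).
  elim: i => [|i IHi] le_i; first by rewrite mulmx1 (_ : inord 0 = 0) //; apply: val_inj; rewrite /= inordK.
  rewrite exprSr -[_ * A]/(_ *m A) mulmxA IHi 1?ltnW // -rowE; apply/rowP=> j.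
  rewrite [LHS]mxE AE mxE /= -val_eqE /= !inordK ?le_i ?andbT //; lia.
have AX i : B *m A ^+ i = A ^+ i *m B by apply: commrX.
(* [p] collects the coordinates of e B on the large block; what remains is the multiple g f, so e R
   = g f. *)
pose p := \poly_(i < N.+1) B 0 (inord i); pose pA := horner_mx A p.
pose R := B - pA; pose g := B 0 ord_max.
have defB : B = pA + R by rewrite addrC subrK.
have pAA i : pA *m A ^+ i = A ^+ i *m pA by apply: comm_horner_mx; apply: commrX.
have RX i : R *m A ^+ i = A ^+ i *m R by rewrite mulmxBl mulmxBr AX pAA.
have eR : e *m R = g *: f.
  rewrite mulmxBr mul_horner_poly -rowE [row 0 B]row_sum_delta big_ord_recr /= mxE.
  rewrite (eq_bigr (fun i : 'I_N.+1 => B 0 (inord i) *: (e *m A ^+ i))).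
    by rewrite addrAC subrr add0r.
  move=> i _; rewrite eA -1?ltnS // mxE.
  have -> // : widen_ord (leqnSn N.+1) i = inord i.
  by apply: val_inj; rewrite /= inordK // ltnW // ltnS.
clearbody R.
have rowP' (X Y : 'M[F]_N.+2) : (forall i, (i <= N)%N -> e *m A ^+ i *m X = e *m A ^+ i *m Y) ->
    f *m X = f *m Y -> X = Y.
  move=> eXY fXY; apply/row_matrixP=> i; rewrite !rowE.
  have [le_i|lt_i] := leqP i N; first by rewrite -[i]inord_val -eA // eXY.
  by have -> : i = ord_max by apply: val_inj => /=; have := ltn_ord i; lia.
have AR : A *m R = 0.
  apply: rowP' => [i le_i|]; rewrite mulmx0; last by rewrite mulmxA fA mul0mx.
  rewrite mulmxA -(mulmxA e) -[A ^+ i *m A]exprSr -mulmxA -RX mulmxA eR.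
  by rewrite exprS -[A * _]/(A *m _) mulmxA -scalemxAl fA scaler0 mul0mx.
have RA : R *m A = 0 by have := RX 1%N; rewrite expr1 AR.
have eAN0 : e *m A ^+ N != 0.
  rewrite eA //; apply/eqP => /rowP/(_ (inord N)); rewrite !mxE !eqxx /=.
  by move/eqP; rewrite oner_eq0.
have RAk k : (0 < k)%N -> R *m A ^+ k = 0.
  by case: k => // k _; rewrite exprS -[A * _]/(A *m _) mulmxA RA mul0mx.
have [q [c p_eq]] : exists q, exists c, p = q * 'X + c%:P.
  by elim/poly_ind: (p) => [|q c _]; [exists 0, 0; rewrite mul0r add0r | exists q, c].
have pAE : pA = horner_mx A q *m A + c%:M.
  by rewrite /pA p_eq rmorphD rmorphM /= horner_mx_X horner_mx_C.
(* The constant term of [p] is the eigenvalue of [B] on e A^N. *)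
have c0 : c = 0.
  apply: nilp_eigen nilB eAN0 _; rewrite -mulmxA -AX defB mulmxDl RAk // addr0 pAE.
  rewrite mulmxDl -mulmxA -[A *m _]exprS AN1 mulmx0 add0r mul_scalar_mx.
  by rewrite scalemxAr.
subst c; rewrite raddf0 addr0 in p_eq; rewrite raddf0 addr0 in pAE.
have qAA : horner_mx A q *m A = A *m horner_mx A q by apply: comm_horner_mx.
have pR : pA *m R = 0 by rewrite pAE -mulmxA AR mulmx0.
have Rp : R *m pA = 0 by rewrite pAE qAA mulmxA RA mul0mx.
have pAN : pA *m A ^+ N = 0 by rewrite pAE -mulmxA -[A *m _]exprS AN1 mulmx0.
have BAN : B *m A ^+ N = 0 by rewrite defB mulmxDl pAN RAk // addr0.
(* f B lies in the kernel of [A], spanned by e A^N and [f]. As [B] kills e A^N, the coefficient on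
   [f] is an eigenvalue of [B] whenever f B is nonzero, hence zero. *)
have [b fB] : exists b, f *m B = b *: (e *m A ^+ N).
  move defw: (f *m B) => w; have wA : w *m A = 0 by rewrite -defw -mulmxA BA mulmxA fA mul0mx.
  have w0 (j : 'I_N.+2) : (j < N)%N -> w 0 j = 0.
    move=> lt_j; have := congr1 (fun v : 'rV[F]_N.+2 => v 0 (inord j.+1)) wA.
    rewrite /= mxE [RHS]mxE (bigD1 j) //= big1 ?addr0 => [|k].
      by rewrite AE inordK ?eqxx ?lt_j ?mulr1 //; lia.
    rewrite -val_eqE AE inordK /=; last by lia.
    by move=> /negPf; rewrite eqSS eq_sym => ->; rewrite mulr0.
  have wE : w = w 0 (inord N) *: (e *m A ^+ N) + w 0 ord_max *: f.
    rewrite eA //; apply/rowP=> j; rewrite !mxE /= -!val_eqE /= inordK //.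
    have [lt_j|] := ltnP j N.
      by rewrite w0 // !ltn_eqF ?mulr0 ?addr0 //; apply: ltnW.
    rewrite leq_eqVlt => /orP[/eqP eq_j|lt_j].
      rewrite [_ == N](_ : _ = true) 1?[_ == N.+1](_ : _ = false); [|lia|lia].
      by rewrite mulr1 mulr0 addr0; congr (w 0 _); apply: val_inj; rewrite /= inordK.
    have -> : j = ord_max by apply: val_inj => /=; have := ltn_ord j; lia.
    by rewrite /= eqxx gtn_eqF // mulr1 mulr0 add0r.
  exists (w 0 (inord N)); have [->|wn0] := eqVneq w 0; first by rewrite mxE scale0r.
  suff w_max : w 0 ord_max = 0 by rewrite {1}wE w_max scale0r addr0.
  apply: nilp_eigen nilB wn0 _; rewrite {1}wE mulmxDl -!scalemxAl defw.
  by rewrite -mulmxA -AX BAN mulmx0 scaler0 add0r.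
have fR : f *m R = f *m B by rewrite defB mulmxDr pAE qAA mulmxA fA mul0mx add0r.
have RR : R *m R = (g * b) *: A ^+ N.
  apply: rowP' => [[|i] le_i|].
  - by rewrite mulmx1 mulmxA eR -scalemxAl fR fB scalerA scalemxAr.
  - rewrite exprSr -[A ^+ i * A]/(_ *m _) -!mulmxA (mulmxA A R) AR mul0mx !mulmx0.
    by rewrite -!scalemxAr -[A *m _]exprS AN1 !mulmx0 scaler0.
  - rewrite mulmxA fR fB -scalemxAl -mulmxA -RX RAk // mulmx0 scaler0.
    by rewrite -scalemxAr fAk // scaler0.
have BB : B *m B = pA *m pA + (g * b) *: A ^+ N.
  by rewrite -RR defB mulmxDl !mulmxDr pR Rp addr0 add0r.
(* [j] is the order of [p] at 0, positive since the constant term vanishes; for p = 0 the value N +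
   1 serves, as A^(N+1) = 0. *)
have [j [u [j0 u0 pAj]]] : exists j, exists u : {poly F},
    [/\ (0 < j)%N, ~~ root u 0 & pA = horner_mx A (u * 'X^j)].
  have [p0|p0] := eqVneq p 0.
    exists N.+1, 1; rewrite root1; split=> //.
    by rewrite /pA p0 rmorph0 mul1r rmorphXn /= horner_mx_X AN1.
  have [k [u /implyP/(_ p0) u0 p_eq']] := multiplicity_XsubC p 0.
  rewrite subr0 in p_eq'; exists k, u; rewrite /pA -p_eq'; split=> //.
  case: k p_eq' => // p_eq'; rewrite expr0 mulr1 in p_eq'; move: u0; rewrite -p_eq' p_eq.
  by rewrite /root hornerMX mulr0 eqxx.
have BBj : B *m B = horner_mx A ((u * 'X^j) ^+ 2 + (g * b) *: 'X^N).
  rewrite BB rmorphD rmorphXn /= -pAj -mul_polyC rmorphM rmorphXn /= horner_mx_C horner_mx_X.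
  by rewrite -[_%:M * _]/(_ *m _) mul_scalar_mx.
have pAU : pA = horner_mx A u *m A ^+ j by rewrite pAj rmorphM rmorphXn /= horner_mx_X.
have BAj : B *m A = horner_mx A u *m A ^+ j.+1.
  by rewrite defB mulmxDl RA addr0 pAU -mulmxA exprSr.
have rA k : (0 < k)%N -> \rank (A ^+ k) = (N.+1 - k)%N.
  by case: k => // k _; rewrite mxrank_jordan_nil_sub.
exists j; split=> // [lt_jN|le_Nj|lt_jN|le_Nj].
(* Factor out X^(2j): the cofactor u^2 + g b X^(N-2j) does not vanish at 0. *)
- rewrite BBj -rA ?double_gt0 //.
  rewrite -(nilp_horner_rank (u := u ^+ 2 + (g * b) *: 'X^(N - j.*2)) nilA).
    rewrite mulrDl -scalerAl -exprD subnK 1?ltnW //.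
    by rewrite exprMn -exprM muln2.
  rewrite /root !hornerE expr0n subn_eq0 leqNgt lt_jN mulr0 addr0 expf_eq0.
  exact: u0.
- have -> : 1%N = \rank (A ^+ N) by rewrite rA //; lia.
  rewrite BBj exprMn -exprM muln2 -(subnK le_Nj) exprD mulrA -mul_polyC -mulrDl.
  by rewrite rmorphM [X in _ * X]rmorphXn /= horner_mx_X; exact: mxrankM_maxr.
(* Every row of [B] but the first lies in the row space of A^(j+1), of rank N - j: for e A^(k+1)
   because B A = u(A) A^(j+1), for [f] because j < N. *)
- have : (B <= row 0 B + A ^+ j.+1)%MS.
    have sA k X : (j < k)%N -> (X *m A ^+ k <= row 0 B + A ^+ j.+1)%MS.
      move=> lt_jk; have -> : A ^+ k = A ^+ (k - j.+1) *m A ^+ j.+1.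
        by rewrite -[RHS]exprD subnK.
      by rewrite mulmxA (submx_trans (submxMl _ _)) // addsmxSr.
    apply/row_subP=> i; have [->|i0] := eqVneq i 0; first exact: addsmxSl.
    rewrite rowE; have [le_i|lt_i] := leqP i N.
      have [k ik] : exists k, (i : nat) = k.+1.
        by exists i.-1; rewrite prednK // lt0n.
      rewrite -[i]inord_val -eA // -mulmxA ik exprSr -[A ^+ k * A]/(_ *m A).
      by rewrite -(mulmxA _ A) -BA BAj !mulmxA sA.
    have -> : i = ord_max by apply: val_inj => /=; have := ltn_ord i; lia.
    by rewrite -/f fB scalemxAl sA.
  move/mxrankS/leq_trans; apply; apply: leq_trans (mxrank_adds_leqif _ _) _.
  have := rank_leq_row (row 0 B); rewrite rA //; lia.
- have : B *m A = 0.
    rewrite BAj.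
    have -> : A ^+ j.+1 = A ^+ (j - N) * A ^+ N.+1 by rewrite -exprD; congr (A ^+ _); lia.
    by rewrite AN1 mulr0 mulmx0.
  move/mulmx0_rank_max; rewrite -[A]expr1 rA //; lia.
Qed.

(** * Necessity of square zero for n >= 4, and the theorem *)

Lemma PNB_full_sq0 {F : fieldType} {n} {B : 'M[F]_n} :
  (4 <= n)%N -> is_nilpotent B -> PNB_full B -> B *m B = 0.
Proof.
case: n B => [|[|N]] // B le_N nilB fullB; apply/eqP; apply: contraT => BB0.
have transport s : is_partition N.+2 s ->
    exists2 D, D *m jordan_nil F N.+2 s = jordan_nil F N.+2 s *m D & sim_mx D B.
  by move=> /fullB[A [_ AB /has_shapeP/sim_mx_sym/sim_mx_comm]]; apply.
have [D1] : exists2 D, D *m jordan_nil F N.+2 [:: N.+2] = jordan_nil F N.+2 [:: N.+2] *m D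
    & sim_mx D B by apply: transport; rewrite /is_partition /= addn0 eqxx.
have [D2] : exists2 D, D *m jordan_nil F N.+2 [:: N.+1; 1%N] =
    jordan_nil F N.+2 [:: N.+1; 1%N] *m D & sim_mx D B.
  by apply: transport; rewrite /is_partition /= addn1 eqxx.
move=> comD2 simD2; rewrite jordan_nil1 => /comm_regular_rank[k [rB1 rBB1]] simD1.
have [|j [j0 rBB2 rBB2' rB2 rB2']] := comm_subregular_rank _ (sim_mx_nilp simD2 nilB) comD2.
  by lia.
rewrite (sim_mx_rank simD1) in rB1; rewrite (sim_mx_rank (sim_mxX 2 simD1)) in rBB1.
rewrite !(sim_mx_rank (sim_mxX 2 simD2)) in rBB2 rBB2'.
rewrite !(sim_mx_rank simD2) in rB2 rB2'.
(* If 2j < N, then N + 2 - 2k = N + 1 - 2j fails by parity. Otherwise B^2 has rank 1, so N = 2k - 1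
   and [B] has rank k + 1 >= 3, while j >= k bounds this rank by k if j < N and by 2 if j >= N. *)
have : (0 < \rank (B ^+ 2))%N by rewrite lt0n mxrank_eq0.
lia.
Qed.

Theorem theorem2p4 (F : closedFieldType) (hF : [pchar F] =i pred0)
    (n : nat) (B : 'M[F]_n) (hB : is_nilpotent B) :
  ((n <= 3)%N -> PNB_full B) /\
  ((4 <= n)%N -> (PNB_full B <-> B *m B = 0)).
Proof.
split=> [le_n|ge_n]; first exact: small_PNB_full.
by split; [apply: PNB_full_sq0|apply: sq0_PNB_full].
Qed.
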